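(* Let $\omega=\frac{-1+\sqrt{-3}}{2}$ and define the Lehmer-Euler numbers $W_n$ by $$\sum_{n=0}^\infty W_n\frac{t^n}{n!}=\frac{3}{e^{t}+e^{\omega t}+e^{\omega^2 t}}=\left(\sum_{l=0}^\infty\frac{t^{3l}}{(3l)!}\right)^{-1}.$$ Then for every non-negative integer $n$, $W_{3n}\in\mathbb{Z}$ and $W_{3n}\equiv(-1)^n\pmod 9$. *)

(* Defs.v *)
From HB Require Import structures.
From mathcomp Require Import all_boot all_order all_algebra.
From mathcomp Require Import ring.

Set Implicit Arguments.
Unset Strict Implicit.
Unset Printing Implicit Defensive.

Import Order.TTheory GRing.Theory Num.Theory.
Local Open Scope ring_scope.

(* [f : fps F] stands for the formal power series \sum_n f n * t^n. *)
Definition fps (F : fieldType) := nat -> F.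

Section FormalPowerSeries.
Variable F : fieldType.
Implicit Types f g : fps F.

Definition fps_const (a : F) : fps F := fun n => if n is 0%N then a else 0.

Definition fps_add f g : fps F := fun n => f n + g n.

Definition fps_mul f g : fps F :=
  fun n => \sum_(k < n.+1) f k * g (n - k)%N.

(* exp (a t) *)
Definition fps_exp (a : F) : fps F := fun n => a ^+ n / n`!%:R.

(* The first [n] coefficients of 1 / f: solving f * g = 1 for the coefficient
   g_m gives f_0 g_m = [m = 0] - \sum_(k < m) f_(m - k) g_k. *)
Definition fps_inv_coefs f (n : nat) : seq F :=
  iter n (fun s => rcons s
    (((size s == 0%N)%:R - \sum_(k < size s) f (size s - k)%N * s`_k) / f 0%N))
    [::].

(* Meaningful when f 0 != 0; see [fps_mulfV] and [fps_inv_unique]. *)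
Definition fps_inv f : fps F := fun n => (fps_inv_coefs f n.+1)`_n.

Definition fps_div f g : fps F := fps_mul f (fps_inv g).

Lemma size_fps_inv_coefs f n : size (fps_inv_coefs f n) = n.
Proof. by elim: n => //= n IHn; rewrite size_rcons IHn. Qed.

Lemma nth_fps_inv_coefs f n k :
  (k < n)%N -> (fps_inv_coefs f n)`_k = fps_inv f k.
Proof.
elim: n => // n IHn; rewrite ltnS leq_eqVlt => /predU1P [-> // | ltkn].
by rewrite /= nth_rcons size_fps_inv_coefs ltkn IHn.
Qed.

Lemma fps_invE f n :
  fps_inv f n =
    ((n == 0%N)%:R - \sum_(k < n) f (n - k)%N * fps_inv f k) / f 0%N.
Proof.
rewrite {1}/fps_inv /= nth_rcons size_fps_inv_coefs ltnn eqxx.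
by under eq_bigr => k _ do rewrite nth_fps_inv_coefs //.
Qed.

Lemma fps_mulC f g : fps_mul f g =1 fps_mul g f.
Proof.
move=> n; rewrite /fps_mul (reindex_inj rev_ord_inj) /=.
by apply: eq_bigr => k _; rewrite subSS mulrC subKn // -ltnS.
Qed.

Lemma fps_mulfV f : f 0%N != 0 -> fps_mul f (fps_inv f) =1 fps_const 1.
Proof.
move=> f0 n; rewrite fps_mulC /fps_mul big_ord_recr /= subnn [fps_inv f n]fps_invE.
rewrite divfK //; under eq_bigr => k _ do rewrite mulrC.
by rewrite addrC subrK; case: n.
Qed.

Lemma fps_inv_unique f g :
  f 0%N != 0 -> fps_mul f g =1 fps_const 1 -> g =1 fps_inv f.
Proof.
move=> f0 fg1; elim/ltn_ind => n IHn; apply: (mulIf f0).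
have := fg1 n; rewrite -(fps_mulfV f0 n) !(fps_mulC f) /fps_mul.
rewrite !big_ord_recr /= subnn; under eq_bigr => k _ do rewrite IHn //.
exact: addrI.
Qed.

Lemma eq_fps_inv f g : f =1 g -> fps_inv f =1 fps_inv g.
Proof.
move=> fg; elim/ltn_ind => n IHn; rewrite !fps_invE fg.
by under eq_bigr => k _ do rewrite fg IHn //.
Qed.

End FormalPowerSeries.

Section LehmerEuler.
Variable C : numClosedFieldType.

Definition omega : C := (-1 + sqrtC (-3)) / 2.

(* e^t + e^(omega t) + e^(omega^2 t) *)
Definition lehmer_euler_den : fps C :=
  fps_add (fps_add (fps_exp 1) (fps_exp omega)) (fps_exp (omega ^+ 2)).

Definition lehmer_euler_gf : fps C :=
  fps_div (fps_const 3) lehmer_euler_den.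

Definition lehmer_euler (n : nat) : C := n`!%:R * lehmer_euler_gf n.

(* \sum_l t^(3l) / (3l)! *)
Definition exp3_series : fps C :=
  fun n => if (3 %| n)%N then n`!%:R^-1 else 0.

Lemma omega_sum : 1 + omega + omega ^+ 2 = 0.
Proof.
suff -> : 1 + omega + omega ^+ 2 = (sqrtC (-3) ^+ 2 + 3) / 4 :> C.
  by rewrite sqrtCK addNr mul0r.
by rewrite /omega; field.
Qed.

Lemma omega3 : omega ^+ 3 = 1.
Proof.
have -> : omega ^+ 3 = (omega - 1) * (1 + omega + omega ^+ 2) + 1 by ring.
by rewrite omega_sum mulr0 add0r.
Qed.

Lemma lehmer_euler_denE n : lehmer_euler_den n = 3 * exp3_series n.
Proof.
rewrite /lehmer_euler_den /fps_add /fps_exp /exp3_series expr1n.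
rewrite -!mulrDl exprAC -(expr_mod n omega3) /dvdn.
have : (n %% 3 < 3)%N by rewrite ltn_mod.
case: (n %% 3)%N => [|[|[|]]] //= _.
- by rewrite expr0 expr1n; congr (_ * _); ring.
- by rewrite expr1 omega_sum mul0r mulr0.
- rewrite -exprM [omega ^+ (2 * 2)]exprS omega3 mulr1 addrAC omega_sum.
  by rewrite mul0r mulr0.
Qed.

Lemma lehmer_euler_den0 : lehmer_euler_den 0 != 0.
Proof. by rewrite lehmer_euler_denE mulf_neq0 ?invr_neq0 ?pnatr_eq0. Qed.

Lemma exp3_series0 : exp3_series 0 != 0.
Proof. by rewrite invr_neq0 ?pnatr_eq0. Qed.

Lemma lehmer_euler_gfE n : lehmer_euler_gf n = 3 * fps_inv lehmer_euler_den n.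
Proof.
rewrite /lehmer_euler_gf /fps_div /fps_mul big_ord_recl /= subn0.
by rewrite big1 ?addr0 // => k _; rewrite mul0r.
Qed.

Lemma lehmer_euler_gf_exp3 : lehmer_euler_gf =1 fps_inv exp3_series.
Proof.
apply: fps_inv_unique exp3_series0 _ => n.
rewrite -(fps_mulfV lehmer_euler_den0) /fps_mul; apply: eq_bigr => k _.
by rewrite lehmer_euler_gfE lehmer_euler_denE mulrCA mulrA.
Qed.

End LehmerEuler.

(* Main.v *)
Require Import Defs.
From mathcomp Require Import all_boot all_order all_algebra.
From mathcomp Require Import ring.

Set Implicit Arguments.
Unset Strict Implicit.
Unset Printing Implicit Defensive.

Import GRing.Theory Num.Theory.
Local Open Scope ring_scope.

(** In the Vandermonde expansion of ['C(p * (m + n), p * k)] for a prime [p],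
    the terms whose index is prime to [p] are products of two multiples of [p].
    Hence ['C(p * n, p * k)] and ['C(n, k)] agree modulo [p ^ 2], so modulo [9]
    the recurrence [\sum_(k <= n) 'C(3 * n, 3 * k) W_(3k) = [n = 0]] becomes
    [\sum_(k <= n) 'C(n, k) W_(3k) = [n = 0]], whose solution is [(-1) ^ n] by
    expanding [(1 - 1) ^ n]. *)

Lemma big_ord_dvdn (R : Type) (idx : R) (op : Monoid.com_law idx) (d n : nat)
    (F : nat -> R) :
  (0 < d)%N ->
  \big[op/idx]_(j < (d * n).+1 | (d %| j)%N) F j =
    \big[op/idx]_(k < n.+1) F (d * k)%N.
Proof.
move=> d_gt0; rewrite (reindex_onto (fun k : 'I_n.+1 => inord (d * k))
                                    (fun j => inord (j %/ d))).
  have lt_mul (k : 'I_n.+1) : (d * k < (d * n).+1)%N.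
    by rewrite ltnS leq_mul2l leq_ord orbT.
  by apply: eq_big => k; rewrite inordK // dvdn_mulr // mulKn // inord_val eqxx.
move=> j d_j; have lt_div : (j %/ d < n.+1)%N.
  by rewrite ltnS leq_divLR // (mulnC n) leq_ord.
by rewrite (inordK lt_div) (mulnC d (j %/ d)%N) divnK // inord_val.
Qed.

Lemma dvdn_bin_mul (d n m : nat) : coprime d m -> (d %| 'C(d * n, m))%N.
Proof.
case: m => [|m] co_dm; first by move: co_dm; rewrite /coprime gcdn0 => /eqP->.
by rewrite -(Gauss_dvdr _ co_dm) -mul_bin_diag -mulnA dvdn_mulr.
Qed.

Lemma sum_signr_bin (R : pzRingType) (n : nat) :
  \sum_(k < n.+1) (-1) ^+ k *+ 'C(n, k) = (n == 0%N)%:R :> R.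
Proof.
rewrite -expr0n -[in RHS](subrr 1) exprBn_comm; last exact: commr1.
by apply: eq_bigr => k _; rewrite !expr1n !mulr1.
Qed.

Section BinomialsModSquare.

Variables (p : nat) (p_pr : prime p).

Lemma Vandermonde_mul_mod (m n k : nat) :
  ('C(p * (m + n), p * k)
    = \sum_(j < k.+1) 'C(p * m, p * j) * 'C(p * n, p * (k - j)) %[mod p ^ 2])%N.
Proof.
pose term j := ('C(p * m, j) * 'C(p * n, p * k - j))%N.
have term_dvd (j : 'I_(p * k).+1) : ~~ (p %| j)%N -> (p ^ 2 %| term j)%N.
  move=> p'j; rewrite dvdn_mul // dvdn_bin_mul // prime_coprime //.
  by rewrite dvdn_subr ?leq_ord // dvdn_mulr.
rewrite mulnDr -binomial.Vandermonde (bigID (fun j => p %| val j)%N) /=.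
rewrite (big_ord_dvdn _ _ term) ?prime_gt0 // -modnDmr.
rewrite (eqnP (dvdn_sum _ term_dvd)) addn0; congr (_ %% _)%N.
by apply: eq_bigr => j _; rewrite /term -mulnBr.
Qed.

Lemma bin_mul_mod (n k : nat) : ('C(p * n, p * k) = 'C(n, k) %[mod p ^ 2])%N.
Proof.
have bin_mul1 j : 'C(p * 1, p * j) = 'C(1, j).
  case: j => [|[|j]]; rewrite ?muln0 ?muln1 ?bin0 ?binn // !bin_small //.
  by rewrite ltn_Pmulr // prime_gt0.
elim: n k => [|n IHn] k.
  by rewrite muln0 !bin0n muln_eq0 (gtn_eqF (prime_gt0 p_pr)).
rewrite -add1n Vandermonde_mul_mod -binomial.Vandermonde.
rewrite -[LHS]modn_summ -[RHS]modn_summ.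
congr (_ %% _)%N; apply: eq_bigr => j _.
by rewrite bin_mul1 -modnMmr IHn modnMmr.
Qed.

Lemma sum_signr_bin_mul_mod (n : nat) :
  (\sum_(k < n.+1) (-1) ^+ k *+ 'C(p * n, p * k) = (n == 0%N)%:R
    %[mod (p ^ 2)%N])%Z.
Proof.
apply/eqP; rewrite eqz_mod_dvd -sum_signr_bin -sumrB.
apply: rpred_sum => k _; rewrite !pmulrn -mulrzBr mulrzz dvdz_mull //.
by rewrite -eqz_mod_dvd !modz_nat bin_mul_mod.
Qed.

End BinomialsModSquare.

Lemma unitriangular_int_mod (R : pzRingType) (m : int) (a : nat -> nat -> nat)
    (b u : nat -> int) (w : nat -> R) :
  (forall n, a n n = 1%N) ->
  (forall n, \sum_(k < n.+1) w k *+ a n k = (b n)%:~R) ->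
  (forall n, \sum_(k < n.+1) u k *+ a n k = b n %[mod m])%Z ->
  forall n, exists z : int, w n = z%:~R /\ (z = u n %[mod m])%Z.
Proof.
move=> a1 w_sol u_sol; elim/ltn_ind=> n IHn.
have /fin_all_exists[z z_spec] (k : 'I_n) := IHn k (ltn_ord k).
exists (b n - \sum_(k < n) z k *+ a n k); split.
  rewrite rmorphB rmorph_sum /= -w_sol big_ord_recr a1 /= addrAC -sumrB.
  by rewrite big1 ?add0r // => k _; rewrite rmorphMn /= -(z_spec k).1 subrr.
have sum_mod :
    (\sum_(k < n) z k *+ a n k = \sum_(k < n) u k *+ a n k %[mod m])%Z.
  apply/eqP; rewrite eqz_mod_dvd -sumrB rpred_sum // => k _.
  by rewrite -mulrnBl rpredMn // -eqz_mod_dvd (z_spec k).2.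
rewrite -modzDml -u_sol modzDml -modzDmr -modzNm sum_mod modzNm modzDmr.
by rewrite big_ord_recr a1 /= addrAC subrr add0r.
Qed.

Lemma bin_mul_inverse_mod (R : pzRingType) (p : nat) (w : nat -> R) :
  prime p ->
  (forall n, \sum_(k < n.+1) w k *+ 'C(p * n, p * k) = (n == 0%N)%:R) ->
  forall n, exists z : int, w n = z%:~R /\ (z = (-1) ^+ n %[mod (p ^ 2)%N])%Z.
Proof.
move=> p_pr w_sol.
apply: (@unitriangular_int_mod _ _ (fun n k => 'C(p * n, p * k))
          (fun n => (n == 0%N)%:R)) => n; first exact: binn.
  by rewrite w_sol rmorph_nat.
exact: sum_signr_bin_mul_mod.
Qed.

Section ExponentialCoefficients.

Variable F : fieldType.
Implicit Types f g : fps F.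

Definition egf_coef f (n : nat) : F := n`!%:R * f n.

Lemma egf_coef_mul f g (n : nat) :
  egf_coef (fps_mul f g) n =
    \sum_(k < n.+1) (egf_coef f k * egf_coef g (n - k)) *+ 'C(n, k).
Proof.
rewrite /egf_coef mulr_sumr; apply: eq_bigr => k _.
rewrite -(bin_fact (leq_ord k)) -mulr_natl !natrM; ring.
Qed.

Lemma egf_coef_inv f (n : nat) :
  f 0%N != 0 ->
  \sum_(k < n.+1) (egf_coef (fps_inv f) k * egf_coef f (n - k)) *+ 'C(n, k)
    = (n == 0%N)%:R.
Proof.
move=> f0; rewrite -egf_coef_mul /egf_coef fps_mulC fps_mulfV //.
by case: n => [|n]; rewrite ?mulr1 ?mulr0.
Qed.

End ExponentialCoefficients.

Section LehmerEulerRecurrence.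

Variable C : numClosedFieldType.

Lemma egf_coef_exp3_series (n : nat) :
  egf_coef (exp3_series C) n = (3 %| n)%N%:R.
Proof.
rewrite /egf_coef /exp3_series; case: ifP; rewrite ?mulr0 // mulfV //.
by rewrite pnatr_eq0 -lt0n fact_gt0.
Qed.

Lemma sum_lehmer_euler_bin (n : nat) :
  \sum_(k < n.+1) lehmer_euler C (3 * k) *+ 'C(3 * n, 3 * k) = (n == 0%N)%:R.
Proof.
have /(egf_coef_inv (3 * n)) := exp3_series0 C; rewrite muln_eq0 /= => <-.
rewrite -(big_ord_dvdn _ _ (fun j => lehmer_euler C j *+ 'C(3 * n, j))) //.
rewrite big_mkcond; apply: eq_bigr => j _ /=.
rewrite egf_coef_exp3_series dvdn_subr ?dvdn_mulr ?leq_ord //.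
rewrite /lehmer_euler lehmer_euler_gf_exp3.
by case: ifP; rewrite ?mulr1 ?mulr0 ?mul0rn.
Qed.

End LehmerEulerRecurrence.

Theorem theorem3 (C : numClosedFieldType) (n : nat) :
  exists w : int,
    lehmer_euler C (3 * n)%N = w%:~R /\ (w = ((-1) ^+ n)%R %[mod 9])%Z.
Proof.
apply: (@bin_mul_inverse_mod C 3 (fun k => lehmer_euler C (3 * k))) => // m.
exact: sum_lehmer_euler_bin.
Qed.
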